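(* Let $n,k,s,l$ be positive integers with $s\geq 1$ and $k,l\geq 2$. There exists an integer $n_0$ such that for all $n\geq n_0$ the following holds: if $\mathcal{H}\subseteq \binom{[n]}{k}$ satisfies $\nu(\mathcal{H})\leq s$, then $$N(S_{k,l}^{k-1},\mathcal{H})\leq N(S_{k,l}^{k-1},\mathcal{H}_{n,k,s}),$$ with equality if and only if $\mathcal{H}\cong \mathcal{H}_{n,k,s}$.
   Context: $[n]=\{1,\dots,n\}$ and $\binom{[n]}{k}$ is the family of all $k$-element subsets of $[n]$. For $\mathcal{H}\subseteq\binom{[n]}{k}$, a matching of size $m$ is a set of $m$ pairwise disjoint members of $\mathcal{H}$; the matching number $\nu(\mathcal{H})$ is the largest size of a matching in $\mathcal{H}$. A family $\{A_1,\dots,A_l\}\subseteq\binom{[n]}{k}$ is a $k$-uniform sunflower with $l$ petals if there is a core set $C\subseteq[n]$ contained in every $A_i$ such that the sets $A_i\setminus C$ are pairwise disjoint. $S_{k,l}^{k-1}$ denotes the $k$-uniform sunflower with $l$ petals whose core has size $k-1$, and $N(S_{k,l}^{k-1},\mathcal{H})$ denotes the number of copies of $S_{k,l}^{k-1}$ in $\mathcal{H}$ (i.e. the number of $l$-element subfamilies of $\mathcal{H}$ forming such a sunflower). $\mathcal{H}_{n,k,s}=\{F\in\binom{[n]}{k}: F\cap[s]\neq\emptyset\}$. $\mathcal{H}\cong\mathcal{H}'$ means the families are equal up to a permutation of $[n]$. *)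

(* Defs.v *)
(* The ground set [n] = {1, ..., n} is represented by
   'I_n = {0, ..., n-1}; in particular [s] is the set of i : 'I_n with i < s. *)
From mathcomp Require Import all_boot all_fingroup.

Set Implicit Arguments.
Unset Strict Implicit.
Unset Printing Implicit Defensive.

Definition uniform_family (T : finType) (k : nat) (H : {set {set T}}) : bool :=
  [forall A in H, #|A| == k].

Definition is_matching (T : finType) (H M : {set {set T}}) : bool :=
  (M \subset H) && trivIset M.

Definition matching_number (T : finType) (H : {set {set T}}) : nat :=
  \max_(M : {set {set T}} | is_matching H M) #|M|.

Definition is_core (T : finType) (S : {set {set T}}) (C : {set T}) : bool :=
  [forall A in S, C \subset A] &&
  [forall A in S, forall B in S,
     (A != B) ==> [disjoint A :\: C & B :\: C]].

Definition is_sunflower (T : finType) (k l c : nat) (S : {set {set T}}) : bool :=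
  [&& uniform_family k S, #|S| == l &
      [exists C : {set T}, (#|C| == c) && is_core S C]].

Definition num_sunflowers (T : finType) (k l c : nat) (H : {set {set T}}) : nat :=
  #|[set S : {set {set T}} | (S \subset H) && is_sunflower k l c S]|.

Definition initial_set (n s : nat) : {set 'I_n} := [set i : 'I_n | i < s].

Definition hit_family (n k s : nat) : {set {set 'I_n}} :=
  [set F : {set 'I_n} | (#|F| == k) && (F :&: initial_set n s != set0)].

Definition family_iso (T : finType) (H H' : {set {set T}}) : Prop :=
  exists p : {perm T}, [set p @: A | A : {set T} in H] = H'.

(* Main.v *)
(* For l >= 2 a sunflower with core size k-1 determines its core, so the number
   of sunflowers is the sum over (k-1)-sets C of binom(codeg C, l).  Call a
   vertex big if its degree exceeds (s+1) k n^(k-2).  Picking disjoint edges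
   greedily through big vertices shows that there are at most s of them, and that
   if there are exactly s then every member of H contains one; H is then a
   subfamily of a copy of the extremal family, and each missing set costs a
   sunflower.  If there are fewer than s big vertices, a maximal matching shows
   that only O(n^(k-2)) members of H avoid them, so cores avoiding the big
   vertices contribute O(n^(k+l-3)), while the extremal family has order
   n^(k-2+l) more sunflowers from cores meeting its s vertices than H can have
   from cores meeting the big ones. *)
Require Import Defs.
From mathcomp Require Import all_boot all_fingroup zify.

Set Implicit Arguments.
Unset Strict Implicit.
Unset Printing Implicit Defensive.

(** * Permutations carrying one set to another, and binomial estimates *)

Lemma exists_perm_imset (T : finType) (X Y : {set T}) :
  #|X| = #|Y| -> exists p : {perm T}, p @: X = Y.
Proof.
move=> eXY.
(* Listing each set before its complement and matching positions gives a bijection that carries [X]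
   to [Y]. *)
pose sX := enum X ++ enum (~: X); pose sY := enum Y ++ enum (~: Y).
have memC (Z : {set T}) x : x \in enum Z ++ enum (~: Z).
  by rewrite mem_cat !mem_enum in_setC orbN.
have uniqC (Z : {set T}) : uniq (enum Z ++ enum (~: Z)).
  rewrite cat_uniq !enum_uniq andbT /=; apply/hasPn => x.
  by rewrite !mem_enum in_setC.
have sizeC (Z : {set T}) : size (enum Z ++ enum (~: Z)) = #|T|.
  by rewrite size_cat -!cardE cardsC.
have ltX x : index x sX < size sY by rewrite sizeC -(sizeC X) index_mem memC.
pose f x := nth x sY (index x sX).
have f_inj : injective f.
  (* The default of [nth] in [f x] is [x] itself; it is changed to [y] so that both values are read
     with the same default. *)
  move=> x y; rewrite /f (set_nth_default y) // => /eqP.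
  rewrite nth_uniq ?uniqC // => /eqP e.
  by rewrite -(nth_index x (memC X x)) -/sX e nth_index ?memC.
exists (perm f_inj); apply/eqP; rewrite eqEcard card_imset; last exact: perm_inj.
rewrite eXY leqnn andbT; apply/subsetP => _ /imsetP[x xX ->].
have lt : index x (enum X) < size (enum Y).
  by rewrite -cardE -eXY cardE index_mem mem_enum.
rewrite permE /f /sY /sX index_cat mem_enum xX nth_cat lt -mem_enum.
exact: mem_nth.
Qed.

Lemma ffact_le_exp n m : n ^_ m <= n ^ m.
Proof.
elim: m => // m IHm; rewrite ffactnSr expnSr.
by apply: leq_mul => //; apply: leq_subr.
Qed.

Lemma bin_le_exp n m : 'C(n, m) <= n ^ m.
Proof.
apply: leq_trans (ffact_le_exp n m).
by rewrite -bin_ffact leq_pmulr // fact_gt0.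
Qed.

Lemma bin_le_exp2 n m : 'C(n, m) <= 2 ^ n.
Proof.
elim: n m => [|n IHn] [|m]; rewrite ?bin0 ?expn_gt0 //.
by rewrite binS expnS mul2n -addnn leq_add.
Qed.

(** Each of the [j] factors of [m ^_ j] exceeds [m - j], hence is at least [n / 2]. *)
Lemma exp_le_bin n m j : n <= 2 * (m - j) -> n ^ j <= 2 ^ j * j`! * 'C(m, j).
Proof.
rewrite -mulnA [_`! * _]mulnC bin_ffact.
elim: j => // j IHj le; rewrite ffactnSr expnSr expnS mulnACA mulnC.
rewrite mulnCA -mulnA; apply: leq_trans (_ : n * (2 ^ j * m ^_ j) <= _).
  by rewrite leq_mul2l IHj ?orbT //; lia.
by have : n <= 2 * (m - j) by [lia]; nia.
Qed.

(** If [d' = 0] then [d <= s], which gives [2 ^ s]; otherwise [d <= s.+1 * d'], and the other [l]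
    factors are at most [n]. The bound is linear in [d'], so it can be summed over cores. *)
Lemma bin_perturb_le s d d' n l : d <= s + d' -> d <= n ->
  'C(d, l.+1) <= 2 ^ s + s.+1 * d' * n ^ l.
Proof.
case: d' => [|d'] le_d le_dn.
  apply: leq_trans (bin_le_exp2 _ _) _; rewrite muln0 addn0 leq_exp2l //; lia.
apply: leq_trans (bin_le_exp _ _) (leq_trans _ (leq_addl _ _)).
rewrite expnS leq_mul //; first by nia.
by case: l => // l; rewrite leq_exp2r.
Qed.

(** * Stars, and sunflowers sorted by core *)

Section Families.

Variable T : finType.
Implicit Types (A C F U W X Y : {set T}) (H M S : {set {set T}}) (k l : nat).

Definition star H C := [set A in H | C \subset A].

(** The extremal family based on an arbitrary set, so that the big vertices can replace
    [initial_set n s]. *)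
Definition hitting k X : {set {set T}} :=
  [set F : {set T} | (#|F| == k) && (F :&: X != set0)].

Lemma uniformP k H :
  reflect {in H, forall A, #|A| = k} (uniform_family k H).
Proof.
apply: (iffP forallP) => [h A AH | h A]; last by apply/implyP => /h ->.
by have /implyP/(_ AH)/eqP := h A.
Qed.

Lemma hitting_uniform k X : uniform_family k (hitting k X).
Proof. by apply/uniformP => A; rewrite inE => /andP[/eqP]. Qed.

Lemma card_supersets k X : #|X| <= k ->
  #|[set A : {set T} | (#|A| == k) && (X \subset A)]|
    = 'C(#|T| - #|X|, k - #|X|).
Proof.
move=> le_Xk; rewrite -[#|T| - _](_ : #|~: X| = _); last first.
  by rewrite -(cardsC X) addKn.
rewrite -cards_draws -[RHS](card_in_imset (f := fun D => X :|: D)).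
  apply: eq_card => A; rewrite inE; apply/andP/imsetP.
    move=> [/eqP cA sXA]; exists (A :\: X).
      by rewrite inE subsetDr /= cardsD (setIidPr sXA) cA.
    by rewrite setDE setUIr setUCr setIT; apply/esym/setUidPr.
  move=> [D]; rewrite inE => /andP[sD /eqP cD] ->; split; last exact: subsetUl.
  have -> : #|X :|: D| = #|X| + #|D|.
    by apply/eqP; rewrite (leq_card_setU X D).2 disjoint_sym disjoints_subset.
  by rewrite cD subnKC.
move=> D E; rewrite !inE => /andP[sD _] /andP[sE _] /setP e.
apply/setP => x; have := e x; rewrite !inE.
case: (boolP (x \in X)) => //= xX _.
have h (Z : {set T}) : Z \subset ~: X -> (x \in Z) = false.
  by move/subsetP => sZ; apply: contraTF xX => /sZ; rewrite inE.
by rewrite !h.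
Qed.

Lemma card_star_le k H X : uniform_family k H -> #|X| <= k ->
  #|star H X| <= 'C(#|T| - #|X|, k - #|X|).
Proof.
move=> /uniformP uH cX; rewrite -card_supersets //.
apply/subset_leq_card/subsetP => A.
by rewrite !inE => /andP[/uH -> ->]; rewrite eqxx.
Qed.

Lemma card_star_hitting k X C : #|C| = k -> ~~ [disjoint C & X] ->
  #|star (hitting k.+1 X) C| = #|T| - k.
Proof.
move=> cC meet.
have -> : #|T| - k = 'C(#|T| - #|C|, k.+1 - #|C|) by rewrite cC subSnn bin1.
rewrite -card_supersets ?cC //; apply: eq_card => A; rewrite !inE -andbA.
congr andb; case: (boolP (C \subset A)) => sCA; rewrite ?andbF // andbT setI_eq0.
by apply: contra meet; apply: disjointWl.
Qed.

(* The core of a sunflower with at least two petals is the intersection of its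
   members, so a sunflower determines its core. *)
Lemma core_unique S C : 1 < #|S| -> is_core S C -> \bigcap_(A in S) A = C.
Proof.
case/card_gt1P => A [B [AS BS neq]] /andP[/forallP sub /forallP dis].
apply/eqP; rewrite eqEsubset; apply/andP; split; last first.
  by apply/bigcapsP => D DS; have := sub D; rewrite DS.
apply/subsetP => x /bigcapP h; apply: contraT => xC.
have /implyP/(_ AS)/forallP/(_ B) := dis A; rewrite BS neq /=.
by move/pred0P/(_ x); rewrite /= !inE xC !h.
Qed.

(** Members of [star H C] exceed [C] by one point each, and distinct members by distinct points, so
    any [l] of them form a sunflower with core [C]. *)
Lemma sunflower_with_core k l H S C : uniform_family k.+1 H -> 1 < l ->
    #|C| = k ->
  [&& S \subset H, is_sunflower k.+1 l k S & \bigcap_(A in S) A == C]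
    = (S \subset star H C) && (#|S| == l).
Proof.
move=> /uniformP uH l1 cC; apply/and3P/andP.
  case=> sSH /and3P[_ cS _] /eqP eC; split=> //.
  apply/subsetP => A AS; rewrite inE (subsetP sSH) //= -eC.
  exact: bigcap_inf.
case=> /subsetP sS cS; have sSH : S \subset H.
  by apply/subsetP => A /sS; rewrite inE => /andP[].
have core : is_core S C.
  apply/andP; split; apply/forallP => A; apply/implyP => /sS.
    by rewrite inE => /andP[].
  rewrite inE => /andP[/uH cA sA]; apply/forallP => B; apply/implyP => /sS.
  rewrite inE => /andP[/uH cB sB]; apply/implyP; apply: contraNT.
  have card1 (Z : {set T}) : #|Z| = k.+1 -> C \subset Z -> #|Z :\: C| == 1.
    by move=> cZ sZ; rewrite cardsD (setIidPr sZ) cZ cC subSnn.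
  have /cards1P[a ea] := card1 A cA sA; have /cards1P[b eb] := card1 B cB sB.
  rewrite ea eb disjoints1 inE negbK => /eqP eab.
  have join (Z : {set T}) : C \subset Z -> Z = (Z :\: C) :|: C.
    by move=> sZ; rewrite setUC setDE setUIr setUCr setIT; apply/esym/setUidPr.
  by rewrite (join A) // (join B) // ea eb eab.
split=> //; last by rewrite (core_unique _ core) // (eqP cS).
rewrite /is_sunflower cS /=; apply/andP; split.
  by apply/uniformP => A AS; apply: uH; apply: (subsetP sSH).
by apply/existsP; exists C; rewrite cC eqxx.
Qed.

Lemma num_sunflowersE k l H : uniform_family k.+1 H -> 1 < l ->
  num_sunflowers k.+1 l k H
    = \sum_(C : {set T} | #|C| == k) 'C(#|star H C|, l).
Proof.
move=> uH l1; rewrite /num_sunflowers -sum1_card.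
rewrite (partition_big (fun S => \bigcap_(A in S) A) (fun C => #|C| == k)) /=.
  apply: eq_bigr => C /eqP cC; rewrite sum1dep_card -cards_draws.
  apply: eq_card => S; rewrite !inE -andbA.
  exact: sunflower_with_core.
move=> S; rewrite inE => /andP[_ /and3P[_ /eqP cS /existsP[C /andP[cC core]]]].
by rewrite (core_unique _ core) ?cS.
Qed.

(** * Invariance under permutations, and proper subfamilies of [hitting] *)

Lemma num_sunflowers_perm k l H (p : {perm T}) : uniform_family k.+1 H -> 1 < l ->
  num_sunflowers k.+1 l k [set p @: A | A : {set T} in H]
    = num_sunflowers k.+1 l k H.
Proof.
move=> uH l1.
have pI : injective p := @perm_inj _ p.
have pI' : injective (fun A : {set T} => p @: A) := imset_inj pI.
have uH' : uniform_family k.+1 [set p @: A | A : {set T} in H].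
  apply/uniformP => _ /imsetP[A AH ->]; rewrite card_imset //.
  exact: (uniformP _ _ uH).
rewrite !num_sunflowersE // (reindex_inj pI') /=.
apply: eq_big => [C | C _]; first by rewrite card_imset.
congr 'C(_, l); rewrite -[RHS](card_imset _ pI'); apply: eq_card => B.
rewrite inE; apply/andP/imsetP.
  case=> /imsetP[A AH ->] sCA; exists A => //; rewrite inE AH /=.
  apply/subsetP => x xC; rewrite -(mem_imset _ _ pI).
  by apply: (subsetP sCA); apply: imset_f.
case=> A; rewrite inE => /andP[AH sCA] ->; split; first exact: imset_f.
exact: imsetS.
Qed.

Lemma num_sunflowers_iso k l H H' : uniform_family k.+1 H -> 1 < l ->
  family_iso H H' -> num_sunflowers k.+1 l k H = num_sunflowers k.+1 l k H'.
Proof. by move=> uH l1 [p <-]; rewrite num_sunflowers_perm. Qed.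

Lemma hitting_iso k X Y : #|X| = #|Y| -> family_iso (hitting k X) (hitting k Y).
Proof.
case/exists_perm_imset => p <-; exists p.
have pI : injective p := @perm_inj _ p.
apply/setP => B; apply/imsetP/idP.
  case=> A; rewrite inE => /andP[cA meet] ->.
  by rewrite inE card_imset // cA /= -(imsetI (in2W pI)) imset_eq0.
rewrite inE => /andP[cB meet].
have eB : B = p @: (p @^-1: B).
  by apply/setP => y; rewrite -{2}[y](permKV p) mem_imset // inE permKV.
exists (p @^-1: B) => //; rewrite inE.
move: cB meet; rewrite {1 2}eB card_imset // => -> /=.
by rewrite -(imsetI (in2W pI)) imset_eq0.
Qed.

(* A missing set [F] meeting [X] in [v] lowers the codegree of [F :\ y], for any
   other [y] in [F], below its maximal value. *)
Lemma num_sunflowers_hitting_lt k l H X : 0 < k -> 1 < l -> l + k <= #|T| ->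
    H \proper hitting k.+1 X ->
  num_sunflowers k.+1 l k H < num_sunflowers k.+1 l k (hitting k.+1 X).
Proof.
move=> k0 l1 big /properP[sH [F Fhit FH]].
have uH : uniform_family k.+1 H.
  by apply/uniformP => A /(subsetP sH); apply: (uniformP _ _ (hitting_uniform _ _)).
rewrite !num_sunflowersE ?hitting_uniform //.
move: (Fhit); rewrite inE => /andP[/eqP cF /set0Pn[v]].
rewrite inE => /andP[vF vX].
have [y] : exists y, y \in F :\ v.
  by apply/set0Pn; rewrite -card_gt0; have := cardsD1 v F; rewrite vF; lia.
rewrite !inE => /andP[yv yF].
have cC : #|F :\ y| = k by have := cardsD1 y F; rewrite yF cF; lia.
have starS C : star H C \subset star (hitting k.+1 X) C.
  by apply/subsetP => A; rewrite !in_set => /andP[/(subsetP sH) + ->]; rewrite inE => ->.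
rewrite (bigD1 (F :\ y)) ?cC //= [ltnRHS](bigD1 (F :\ y)) ?cC //=.
rewrite -addSn leq_add //; last first.
  by apply: leq_sum => C _; apply/leq_bin2l/subset_leq_card.
have ltC : #|star H (F :\ y)| < #|star (hitting k.+1 X) (F :\ y)|.
  apply: proper_card; apply/properP; split=> //; exists F.
    by rewrite inE Fhit subD1set.
  by rewrite inE (negPf FH).
have eC : #|star (hitting k.+1 X) (F :\ y)| = #|T| - k.
  apply: card_star_hitting => //; apply/pred0Pn; exists v.
  by rewrite /= !inE eq_sym yv vF.
rewrite eC in ltC *.
(* By Pascal's rule, lowering the maximal codegree [m.+1] to [m] loses a binomial coefficient that
   is positive because [l + k <= #|T|]. *)
have [m em] : exists m, #|T| - k = m.+1 by exists (#|T| - k).-1; lia.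
case: l l1 big => // l l1 big.
rewrite em ltnS in ltC *; rewrite binS -[ltnLHS]addn0 -addnS leq_add //.
  exact: leq_bin2l.
by rewrite bin_gt0; lia.
Qed.

(** * Greedy and maximal matchings *)

Lemma card_bigcup_le (I : finType) (P : {pred I}) (F : I -> {set {set T}}) :
  #|\bigcup_(i in P) F i| <= \sum_(i in P) #|F i|.
Proof.
elim/big_ind2: _ => // [|S a S' b le1 le2]; first by rewrite cards0.
by apply: leq_trans (leq_add le1 le2); rewrite leq_card_setU.
Qed.

(** Each [u] in [U] shares at most [#|T| ^ k] members with [v], too few in total to exhaust the star
    of [v]. *)
Lemma edge_avoiding k H v U : uniform_family k.+2 H -> v \notin U ->
    #|U| * #|T| ^ k < #|star H [set v]| ->
  exists2 A, A \in H & (v \in A) && [disjoint A & U].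
Proof.
move=> uH vU; rewrite ltnNge => many; apply/exists_inP.
apply: contraNT many => /exists_inPn none.
apply: (@leq_trans (\sum_(u in U) #|star H [set v; u]|)); last first.
  rewrite -sum_nat_const; apply: leq_sum => u uU.
  have c2 : #|[set v; u]| = 2.
    by rewrite cards2; case: eqP uU vU => // -> ->.
  apply: leq_trans (card_star_le uH _) _; rewrite c2 // !subSS subn0.
  apply: leq_trans (bin_le_exp _ _) _.
  by case: (k) => // j; rewrite leq_exp2r // leq_subr.
apply: leq_trans (card_bigcup_le _ _); apply/subset_leq_card/subsetP => A.
rewrite inE sub1set => /andP[AH vA]; have := none A AH; rewrite vA /=.
case/pred0Pn => u /= /andP[uA uU]; apply/bigcupP; exists u => //.
by rewrite inE AH subUset !sub1set vA uA.
Qed.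

Lemma matching_extend k H M A : uniform_family k.+1 H -> is_matching H M ->
    A \in H -> {in M, forall B : {set T}, [disjoint A & B]} ->
  is_matching H (A |: M) /\ #|A |: M| = #|M|.+1.
Proof.
move=> /uniformP uH /andP[sM tM] AH dis.
have M0 : set0 \notin M.
  by apply/negP => /(subsetP sM)/uH; rewrite cards0.
have [tAM AM] := trivIsetU1 dis tM M0.
by rewrite /is_matching subUset sub1set AH sM tAM cardsU1 AM.
Qed.

Lemma matching_le H M : is_matching H M -> #|M| <= matching_number H.
Proof. by move=> mM; apply: (@leq_bigmax_cond _ _ (fun M => #|M|) M). Qed.

(** Induction on [#|W|], with [U] the vertices to avoid. The edge chosen through [v] also avoids the
    rest of [W]; moving [v] out of [W] and the [k.+2] vertices of the edge into [U] preserves the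
    budget [s.+1 * k.+2]. *)
Lemma greedy_matching k s H W U : uniform_family k.+2 H ->
    {in W, forall v, s.+1 * k.+2 * #|T| ^ k < #|star H [set v]|} ->
    [disjoint W & U] -> #|U| + k.+2 * #|W| <= s.+1 * k.+2 ->
  exists M, [/\ is_matching H M, #|M| = #|W| &
                {in M, forall A : {set T}, [disjoint A & U]}].
Proof.
move=> uH; move eW : #|W| => w; elim: w W U eW => [|w IHw] W U eW big disWU le.
  exists set0; rewrite cards0; split=> // [|A]; last by rewrite inE.
  by rewrite /is_matching sub0set; apply/trivIsetP => A B; rewrite inE.
have /card_gt0P[v vW] : 0 < #|W| by rewrite eW.
have eW' : #|W :\ v| = w by have := cardsD1 v W; rewrite vW eW; lia.
have vU : v \notin U by rewrite (disjointFr disWU).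
have [|||A AH /andP[vA disA]] := @edge_avoiding k H v (U :|: W :\ v) => //.
- by rewrite !inE eqxx (negPf vU).
- apply: leq_ltn_trans (big v vW); rewrite leq_mul2r; apply/orP; right.
  apply: leq_trans (leq_card_setU _ _).1 _; rewrite eW'; apply: leq_trans le.
  by rewrite leq_add2l mulSn; nia.
move: disA; rewrite disjoints_subset setCU subsetI -!disjoints_subset.
case/andP=> disAU disAW.
have [|||M [mM cM disM]] := IHw (W :\ v) (U :|: A) eW'.
- by move=> u /setD1P[_ /big].
- rewrite disjoint_sym disjoints_subset subUset -!disjoints_subset disAW andbT.
  by rewrite disjoint_sym (disjointWl _ disWU) // subD1set.
- apply: leq_trans (leq_add (leq_card_setU _ _).1 (leqnn _)) _.
  by rewrite (uniformP _ _ uH A AH) -addnA -mulnS.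
have [|mAM cAM] := matching_extend uH mM AH.
  move=> B /disM; rewrite disjoint_sym disjoints_subset subUset.
  by rewrite -!disjoints_subset => /andP[].
exists (A |: M); split=> //; first by rewrite cAM cM.
move=> B /setU1P[-> //|/disM]; rewrite disjoint_sym disjoints_subset subUset.
by rewrite -!disjoints_subset disjoint_sym => /andP[].
Qed.

(** By maximality every member meets the cover of a largest matching, which has at most [s * k.+1]
    vertices; so the stars of these vertices exhaust [H]. *)
Lemma card_le_matching k s D H : uniform_family k.+1 H ->
    matching_number H <= s -> (forall v, #|star H [set v]| <= D) ->
  #|H| <= s * k.+1 * D.
Proof.
move=> uH nu deg.
have m0 : is_matching H set0.
  by rewrite /is_matching sub0set; apply/trivIsetP => A B; rewrite inE.
case: (@arg_maxnP _ set0 (is_matching H) (fun M => #|M|) m0) => M mM max.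
have sM : M \subset H by case/andP: mM.
have cov : #|cover M| <= s * k.+1.
  apply: leq_trans (leq_card_cover M).1 _.
  rewrite (eq_bigr (fun=> k.+1)) => [|A AM]; last first.
    by apply: (uniformP _ _ uH); apply: (subsetP sM).
  by rewrite sum_nat_const leq_mul2r (leq_trans (matching_le mM) nu) orbT.
apply: (@leq_trans (\sum_(v in cover M) #|star H [set v]|)); last first.
  apply: leq_trans (leq_sum _ (fun v _ => deg v)) _.
  by rewrite sum_nat_const leq_mul2r cov orbT.
apply: leq_trans (card_bigcup_le _ _); apply/subset_leq_card/subsetP => A AH.
apply: contraT => notcov.
have dis : {in M, forall B : {set T}, [disjoint A & B]}.
  move=> B BM; apply/pred0P => x /=; apply: contraNF notcov => /andP[xA xB].
  apply/bigcupP; exists x; last by rewrite inE AH sub1set.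
  by apply/bigcupP; exists B.
have [mAM cAM] := matching_extend uH mM AH dis.
by have := max _ mAM; rewrite cAM /= ltnn.
Qed.

(** * Codegrees and cores meeting a given set *)

Lemma sum_codegree k H : uniform_family k.+1 H ->
  \sum_(C : {set T} | #|C| == k) #|star H C| = #|H| * k.+1.
Proof.
move=> /uniformP uH; under eq_bigr do rewrite -sum1dep_card.
rewrite (exchange_big_dep (mem H)) /=; last by move=> C A _ /andP[].
rewrite -sum_nat_const; apply: eq_bigr => A AH.
rewrite sum1dep_card -[RHS]binSn -(uH A AH) -cards_draws.
by apply: eq_card => C; rewrite !inE AH andbC.
Qed.

(** A member that contains [C] and meets [X] has the form [x |: C] with [x] in [X], so there are at
    most [#|X|] of these. *)
Lemma codegree_split k H X C : uniform_family k.+1 H -> #|C| = k ->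
    [disjoint C & X] ->
  #|star H C| <= #|X| + #|star [set A in H | [disjoint A & X]] C|.
Proof.
move=> /uniformP uH cC disCX.
set H' := [set A in H | _].
apply: (@leq_trans #|[set x |: C | x in X] :|: star H' C|).
  apply/subset_leq_card/subsetP => A; rewrite !inE => /andP[AH sCA].
  rewrite AH sCA andbT /=; case: (boolP [disjoint A & X]) => [|]; first by rewrite orbT.
  case/pred0Pn => x /= /andP[xA xX]; rewrite orbF; apply/imsetP; exists x => //.
  apply/esym/eqP; rewrite eqEcard subUset sub1set xA sCA (uH A AH) cardsU1 cC.
  by rewrite (disjointFl disCX xX) add1n leqnn.
by apply: leq_trans (leq_card_setU _ _).1 _; rewrite leq_add2r leq_imset_card.
Qed.

Lemma card_sets_meeting k X :
  #|[set C : {set T} | (#|C| == k) && ~~ [disjoint C & X]]| + 'C(#|T| - #|X|, k)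
    = 'C(#|T|, k).
Proof.
rewrite -[#|T| - _](_ : #|~: X| = _); last by rewrite -(cardsC X) addKn.
rewrite -card_draws -cards_draws.
rewrite -[RHS](cardsID [set C : {set T} | [disjoint C & X]]) addnC.
by congr (_ + _); apply: eq_card => C; rewrite !inE ?disjoints_subset andbC.
Qed.

(** Counting complements, the difference is at least that for [#|X| = #|Y| - 1], where Pascal's rule
    evaluates it. *)
Lemma card_sets_meeting_gap k X Y : #|X| < #|Y| ->
  #|[set C : {set T} | (#|C| == k.+1) && ~~ [disjoint C & X]]|
      + 'C(#|T| - #|Y|, k)
    <= #|[set C : {set T} | (#|C| == k.+1) && ~~ [disjoint C & Y]]|.
Proof.
move=> ltXY; have leY : #|Y| <= #|T| := max_card _.
have := card_sets_meeting k.+1 X; have := card_sets_meeting k.+1 Y.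
have le : (#|T| - #|Y|).+1 <= #|T| - #|X| by lia.
by have := leq_bin2l k.+1 le; rewrite binS; lia.
Qed.

Lemma num_sunflowers_hitting_ge k l X : 1 < l ->
  #|[set C : {set T} | (#|C| == k) && ~~ [disjoint C & X]]| * 'C(#|T| - k, l)
    <= num_sunflowers k.+1 l k (hitting k.+1 X).
Proof.
move=> l1; rewrite num_sunflowersE ?hitting_uniform //.
rewrite (bigID (fun C => ~~ [disjoint C & X])) /= -sum_nat_const.
apply: leq_trans (leq_addr _ _); rewrite big_set /=.
by apply/eq_leq/eq_bigr => C /andP[/eqP cC meet]; rewrite card_star_hitting.
Qed.

(* Cores meeting [X] get the trivial codegree bound; for the others all but
   [#|X|] of the petals come from members of [H] missing [X]. *)
Lemma num_sunflowers_le k l s H X : uniform_family k.+1 H -> #|X| <= s ->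
  num_sunflowers k.+1 l.+2 k H <=
    #|[set C : {set T} | (#|C| == k) && ~~ [disjoint C & X]]|
        * 'C(#|T| - k, l.+2)
    + ('C(#|T|, k) * 2 ^ s
       + s.+1 * (#|[set A in H | [disjoint A & X]]| * k.+1) * #|T| ^ l.+1).
Proof.
move=> uH cX; rewrite num_sunflowersE //.
have star_le C : #|C| = k -> #|star H C| <= #|T| - k.
  move=> cC; apply: leq_trans (card_star_le uH _) _; rewrite cC //.
  by rewrite subSnn bin1.
rewrite (bigID (fun C => ~~ [disjoint C & X])) /= -sum_nat_const.
apply: leq_add.
  rewrite big_set /=; apply: leq_sum => C /andP[/eqP cC _].
  exact/leq_bin2l/star_le.
set H' := [set A in H | _].
have uH' : uniform_family k.+1 H'.
  by apply/uniformP => A; rewrite inE => /andP[/(uniformP _ _ uH)].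
(* Both error terms become sums over all [k]-sets, so that [bin_perturb_le] applies core by core;
   the right-hand summands for cores meeting [X] are dropped. *)
have -> : 'C(#|T|, k) * 2 ^ s = \sum_(C : {set T} | #|C| == k) 2 ^ s.
  by rewrite -card_draws -sum_nat_const; apply: eq_bigl => C; rewrite inE.
rewrite -(sum_codegree uH') big_distrr big_distrl /= -big_split /=.
rewrite [leqRHS](bigID (fun C => ~~ [disjoint C & X])) /=.
apply: leq_trans (leq_addl _ _); apply: leq_sum => C /andP[/eqP cC].
rewrite negbK => disCX; apply: bin_perturb_le.
  by apply: leq_trans (codegree_split uH cC disCX) _; rewrite leq_add2r.
by apply: leq_trans (star_le C cC) (leq_subr _ _).
Qed.

(** * Big vertices *)

(** The factor [s.+1 * k.+2] is the number of vertices in [s.+1] disjoint edges, which bounds how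
    many vertices the greedy choice must avoid. *)
Definition big_vertices k s H :=
  [set v | s.+1 * k.+2 * #|T| ^ k < #|star H [set v]|].

Lemma card_big_vertices k s H : uniform_family k.+2 H ->
  matching_number H <= s -> #|big_vertices k s H| <= s.
Proof.
move=> uH nu; rewrite leqNgt; apply/negP => many.
have [W sW cW] : exists2 W : {set T}, W \subset big_vertices k s H & #|W| = s.+1.
  have : 0 < #|[set W : {set T} | W \subset big_vertices k s H & #|W| == s.+1]|.
    by rewrite cards_draws bin_gt0.
  by case/card_gt0P => W; rewrite inE => /andP[sW /eqP cW]; exists W.
have [|||M [mM cM _]] := @greedy_matching k s H W set0 uH.
- by move=> v /(subsetP sW); rewrite inE.
- by rewrite disjoints_subset setC0 subsetT.
- by rewrite cards0 cW mulnC.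
by have := matching_le mM; rewrite cM cW; lia.
Qed.

Lemma sub_hitting_big_vertices k s H : uniform_family k.+2 H ->
    matching_number H <= s -> #|big_vertices k s H| = s ->
  H \subset hitting k.+2 (big_vertices k s H).
Proof.
move=> uH nu cB; apply/subsetP => F FH; rewrite inE (uniformP _ _ uH F FH) eqxx.
rewrite /= setI_eq0; apply/negP => disF.
(* The vertices of [F] are forbidden from the start, so that [F] extends the [s] edges found to a
   matching of size [s.+1]. *)
have [|||M [mM cM disM]] := @greedy_matching k s H (big_vertices k s H) F uH.
- by move=> v; rewrite inE.
- by rewrite disjoint_sym.
- by rewrite cB (uniformP _ _ uH F FH) -mulnS mulnC.
have [|mFM cFM] := matching_extend uH mM FH.
  by move=> B /disM; rewrite disjoint_sym.
by have := matching_le mFM; rewrite cFM cM cB; lia.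
Qed.

(** In the subfamily a big vertex has degree 0 and any other vertex has degree at most the
    threshold, so [card_le_matching] applies. *)
Lemma card_missing_big_vertices k s H : uniform_family k.+2 H ->
    matching_number H <= s ->
  #|[set A in H | [disjoint A & big_vertices k s H]]|
    <= s * k.+2 * (s.+1 * k.+2 * #|T| ^ k).
Proof.
move=> uH nu; set H' := [set A in H | _].
have sH' : H' \subset H by apply/subsetP => A; rewrite inE => /andP[].
apply: (@card_le_matching k.+1 s).
- by apply/uniformP => A /(subsetP sH')/(uniformP _ _ uH).
- apply: leq_trans nu; apply/bigmax_leqP => M /andP[sM tM].
  by apply: matching_le; rewrite /is_matching tM (subset_trans sM).
move=> v; case: (boolP (v \in big_vertices k s H)) => vB.
  rewrite (_ : star H' _ = set0) ?cards0 //; apply/setP => A; rewrite !inE sub1set.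
  by apply/negP => /andP[/andP[_ dis] vA]; rewrite (disjointFr dis vA) in vB.
move: vB; rewrite inE -leqNgt; apply: leq_trans; apply/subset_leq_card.
by apply/subsetP => A; rewrite !inE => /andP[/andP[-> _] ->].
Qed.

(** * Comparison when fewer than [s] vertices are big *)

(** The coefficient of [n ^ (k + l.+1)] in the bound for cores missing the big vertices. *)
Definition error_const k s :=
  2 ^ s + s.+1 * (s * k.+2 * (s.+1 * k.+2) * k.+2).

(** The product of the two constants of [exp_le_bin] for the exponents [k] and [l.+2]. *)
Definition gain_const k l := 2 ^ k * k`! * (2 ^ l.+2 * l.+2`!).

(* The error term has order n^(k+l+1), one less than the gain. *)
Lemma num_sunflowers_lt k l s H Y : uniform_family k.+2 H ->
    matching_number H <= s -> #|Y| = s -> #|big_vertices k s H| < s ->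
    2 * (s + k + l + 3) <= #|T| -> error_const k s * gain_const k l < #|T| ->
  num_sunflowers k.+2 l.+2 k.+1 H
    < num_sunflowers k.+2 l.+2 k.+1 (hitting k.+2 Y).
Proof.
move=> uH nu cY; set B := big_vertices k s H => ltB large1 large2.
set n := #|T| in large1 large2.
apply: leq_trans (num_sunflowers_hitting_ge k.+1 Y (isT : 1 < l.+2)).
have gap : #|B| < #|Y| by rewrite cY.
apply: leq_trans (leq_mul (card_sets_meeting_gap k gap) (leqnn _)).
rewrite mulnDl; apply: leq_ltn_trans (num_sunflowers_le l uH (ltnW ltB)) _.
(* The contribution of cores meeting [B] cancels; the error must be beaten by ['C(n - s, k)] extra
   cores of maximal codegree. *)
rewrite ltn_add2l -/n cY.
apply: (@leq_ltn_trans (error_const k s * n ^ (k + l.+1))).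
  rewrite /error_const mulnDl leq_add //.
    rewrite mulnC leq_mul2l; apply/orP; right.
    apply: leq_trans (bin_le_exp _ _) _; rewrite leq_pexp2l //; lia.
  rewrite expnD -!mulnA leq_mul2l; apply/orP; right.
  have := card_missing_big_vertices uH nu; rewrite -/n -/B.
  rewrite -(leq_pmul2r (_ : 0 < k.+2 * n ^ l.+1)) //; last first.
    by rewrite muln_gt0 expn_gt0 /=; lia.
  by rewrite !mulnA; move/leq_trans; apply; apply/eq_leq; lia.
rewrite -(ltn_pmul2l (_ : 0 < gain_const k l)); last first.
  by rewrite /gain_const !(expn_gt0, fact_gt0, muln_gt0).
have gain1 := @exp_le_bin n (n - s) k.
have gain2 := @exp_le_bin n (n - k.+1) l.+2.
(* The spare factor [n] absorbs both constants by [large2]; [large1] provides the hypotheses of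
   [exp_le_bin]. *)
apply: (@leq_trans (n ^ k * n ^ l.+2)).
  rewrite -expnD [k + l.+2]addnS expnS mulnA [gain_const _ _ * _]mulnC.
  rewrite ltn_pmul2r //.
  by rewrite expn_gt0; lia.
rewrite /gain_const mulnACA; apply: leq_mul; [apply: gain1 | apply: gain2]; lia.
Qed.

End Families.

(** * Case split on the number of big vertices *)

Theorem theorem1p6 (k s l : nat) (hs : 1 <= s) (hk : 2 <= k) (hl : 2 <= l) :
  exists n0 : nat, forall n : nat, n0 <= n ->
    forall H : {set {set 'I_n}},
      uniform_family k H -> matching_number H <= s ->
      num_sunflowers k l (k - 1) H
        <= num_sunflowers k l (k - 1) (hit_family n k s)
      /\ (num_sunflowers k l (k - 1) H
            = num_sunflowers k l (k - 1) (hit_family n k s)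
          <-> family_iso H (hit_family n k s)).
Proof.
case: k hk => [|[|k]] // _; case: l hl => [|[|l]] // _; rewrite subn1 /=.
exists (2 * (s + k + l + 3) + (error_const k s * gain_const k l).+1).
move=> n le_n H uH nu.
have cI : #|'I_n| = n := card_ord n.
have cY : #|initial_set n s| = s.
  have le : s <= n by lia.
  have winj : injective (widen_ord le) by move=> i j [] /val_inj.
  rewrite -[RHS]card_ord -(card_imset _ winj).
  apply: eq_card => i; rewrite inE.
  apply/idP/imsetP => [lt | [j _ ->]]; last exact: (ltn_ord j).
  by exists (Ordinal lt) => //; apply: val_inj.
(* This direction of the equality criterion holds in every case; for the converse, [H] is either a
   copy of the extremal family or has strictly fewer sunflowers. *)
have iso_eq : family_iso H (hit_family n k.+2 s) ->
    num_sunflowers k.+2 l.+2 k.+1 H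
      = num_sunflowers k.+2 l.+2 k.+1 (hit_family n k.+2 s).
  exact: num_sunflowers_iso.
set B := big_vertices k s H.
have := card_big_vertices uH nu; rewrite leq_eqVlt => /orP[/eqP cB | ltB].
  have isoB : family_iso (hitting k.+2 B) (hit_family n k.+2 s).
    by apply: hitting_iso; rewrite cB cY.
  have NB := num_sunflowers_iso (hitting_uniform k.+2 B) (isT : 1 < l.+2) isoB.
  have := sub_hitting_big_vertices uH nu cB.
  rewrite subEproper -/B => /orP[/eqP eH | ltH].
    have isoH : family_iso H (hit_family n k.+2 s) by rewrite eH.
    by rewrite (iso_eq isoH).
  have large : l.+2 + k.+1 <= #|'I_n| by rewrite cI; lia.
  have := num_sunflowers_hitting_lt (isT : 0 < k.+1) (isT : 1 < l.+2) large ltH.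
  rewrite NB => lt.
  by split; [exact: ltnW | split=> // e; rewrite e ltnn in lt].
have lt : num_sunflowers k.+2 l.+2 k.+1 H
    < num_sunflowers k.+2 l.+2 k.+1 (hit_family n k.+2 s).
  by apply: (num_sunflowers_lt uH nu cY ltB); rewrite cI; lia.
by split; [exact: ltnW | split=> // e; rewrite e ltnn in lt].
Qed.
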